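(* Let $\lambda \subset \mathbb{N}^2$ be a Young diagram. Then there is a bijection $\sigma \mapsto (\rho, \pi)$ between the set of skew plane partitions $\sigma$ of shape $(\emptyset,\emptyset,\lambda)$ and the set of pairs $(\rho,\pi)$ consisting of a reverse plane partition $\rho$ of shape $(\emptyset,\emptyset,\lambda)$ and a plane partition $\pi$, which is weight-preserving in the sense that $|\sigma| = |\rho| + |\pi|$.
   Context: $\mathbb{N} = \{1,2,\dots\}$ and $\mathbb{N}_{\ge 0} = \{0,1,2,\dots\}$. A partition is a weakly decreasing sequence $\lambda = (\lambda_1,\lambda_2,\dots)$ of nonnegative integers with finitely many nonzero terms; it is identified with its Young diagram $\{(i,j)\in\mathbb{N}^2 \mid 1\le j\le \lambda_i\}$. A plane partition is a function $\pi:\mathbb{N}^2\to\mathbb{N}_{\ge 0}$ with $\pi(i,j)\ge\pi(i+1,j)$ and $\pi(i,j)\ge\pi(i,j+1)$ for all $i,j$, and only finitely many nonzero values. A reverse plane partition (RPP) of shape $(\emptyset,\emptyset,\lambda)$ is a function $\rho:\lambda\to\mathbb{N}_{\ge0}$ with $\rho(i,j)\le\rho(i+1,j)$ and $\rho(i,j)\le\rho(i,j+1)$ whenever both sides are defined. A skew plane partition (SPP) of shape $(\emptyset,\emptyset,\lambda)$ is a function $\sigma:\mathbb{N}^2\setminus\lambda\to\mathbb{N}_{\ge0}$ with $\sigma(i,j)\ge\sigma(i+1,j)$ and $\sigma(i,j)\ge\sigma(i,j+1)$ for all $(i,j)\in\mathbb{N}^2\setminus\lambda$, and only finitely many nonzero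 values. In each case the weight $|\cdot|$ is the sum of all entries. *)

(* Defs.v *)
From mathcomp Require Import all_boot all_classical.

Set Implicit Arguments.
Unset Strict Implicit.
Unset Printing Implicit Defensive.

Local Open Scope classical_set_scope.

(* Rows, columns and parts are numbered from 0 rather than from 1: [lam i] is
   the part usually written lambda_{i+1}, and the box (i, j) is the one usually
   written (i+1, j+1). *)
Definition is_partition (lam : nat -> nat) : Prop :=
  (forall i, lam i.+1 <= lam i) /\ finite_set [set i | lam i != 0].

Definition diagram (lam : nat -> nat) : pred (nat * nat) :=
  fun b => b.2 < lam b.1.

Definition inside (lam : nat -> nat) : Type := {b : nat * nat | diagram lam b}.
Definition outside (lam : nat -> nat) : Type :=
  {b : nat * nat | ~~ diagram lam b}.

Definition next_box (b c : nat * nat) : Prop :=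
  c = (b.1.+1, b.2) \/ c = (b.1, b.2.+1).

Definition finitely_supported (I : Type) (f : I -> nat) : Prop :=
  finite_set [set x | f x != 0].

(* The big operator ranges over the support of [f], so this is the sum of all
   entries when [f] is finitely supported (and 0 otherwise). *)
Definition weight (I : choiceType) (f : I -> nat) : nat :=
  \big[addn/0]_(x \in [set: I]) f x.

Definition plane_partition : set (nat * nat -> nat) :=
  [set p | (forall b c, next_box b c -> p c <= p b) /\ finitely_supported p].

Definition reverse_plane_partition (lam : nat -> nat) :
    set (inside lam -> nat) :=
  [set r | forall x y : inside lam, next_box (val x) (val y) -> r x <= r y].

(* When [lam] is a partition, both [next_box] neighbours of a box outside its
   diagram are again outside, so no inequality is lost by quantifying over
   pairs of outside boxes. *)
Definition skew_plane_partition (lam : nat -> nat) :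
    set (outside lam -> nat) :=
  [set s | (forall x y : outside lam, next_box (val x) (val y) -> s y <= s x) /\
           finitely_supported s].

Arguments reverse_plane_partition lam _ : clear implicits.
Arguments skew_plane_partition lam _ : clear implicits.

(* Main.v *)
(* Labelling the unit steps of the boundary of lambda by consecutive integers,
   a skew plane partition is peeled box by box: piecewise-linear toggles on one
   diagonal remove a corner b of the complement of lambda, at the price of an
   integer read off at b.  Each peeling exchanges the labels of the two boundary
   steps at b, and its integer contributes to the weight with the difference of
   these labels, which is the distance in the boundary between the row and the
   column of b.  So skew plane partitions correspond to finitely supported
   arrays on the complement of lambda, weighted by outer hooks.  Rotating by a
   half-turn in an n by n square, reverse plane partitions of shape lambda are
   skew plane partitions supported in that square, hence correspond to arrays on
   lambda weighted by its hooks.  Finally, for every d there are exactly d more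
   outer hooks of length d than inner ones, as many as boxes (i, j) of the
   quadrant with i + j + 1 = d, the outer hooks of the empty diagram. *)

Require Import Defs.
From mathcomp Require Import all_boot all_order all_algebra all_classical.
From mathcomp Require Import zify ring.

Set Implicit Arguments.
Unset Strict Implicit.
Unset Printing Implicit Defensive.

Local Open Scope classical_set_scope.

(** * Finite sums and weight-preserving bijections *)

(** Both sides reduce to the indices common to [s] and [t], and on those the two lists are
    permutations of each other. *)
Lemma eq_big_support (R : Type) (idx : R) (op : Monoid.com_law idx) (I : eqType)
    (s t : seq I) (F : I -> R) :
  uniq s -> uniq t -> (forall i, i \notin s -> F i = idx) ->
  (forall i, i \notin t -> F i = idx) ->
  \big[op/idx]_(i <- s) F i = \big[op/idx]_(i <- t) F i.
Proof.
have restrict (u v : seq I) : (forall i, i \notin v -> F i = idx) ->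
    \big[op/idx]_(i <- u) F i = \big[op/idx]_(i <- u | i \in v) F i.
  move=> v0; rewrite (bigID (mem v)) /= [X in op _ X]big1 ?Monoid.mulm1 //.
move=> us ut s0 t0; rewrite (restrict s t) // (restrict t s) //.
rewrite -[LHS]big_filter -[RHS]big_filter; apply: perm_big.
apply: uniq_perm; rewrite ?filter_uniq //.
by move=> i; rewrite !mem_filter andbC.
Qed.

Lemma finitely_supportedP (I : choiceType) (f : I -> nat) :
  finitely_supported f <->
  exists2 s : seq I, uniq s & forall i, i \notin s -> f i = 0.
Proof.
split.
  move=> /finite_seqP[s sE]; exists (undup s); first exact: undup_uniq.
  move=> i; rewrite mem_undup => /negP si; apply/eqP/negPn/negP => fi; apply: si.
  by have : [set i | f i != 0] i by []; rewrite sE.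
move=> [s _ s0]; apply: (@sub_finite_set _ _ [set` s]); last exact: finite_seq.
by move=> i /=; apply: contraNT => /s0 ->.
Qed.

Lemma weight_seq (I : choiceType) (s : seq I) (f : I -> nat) :
  uniq s -> (forall i, i \notin s -> f i = 0) ->
  weight f = \sum_(i <- s) f i.
Proof.
move=> us s0; rewrite /weight (@fsbigE _ _ _ _ _ s) //.
  by apply: eq_bigl => i; rewrite in_setT.
by move=> i _ /s0.
Qed.

(** [phi] is constrained on the support of [f] only. This suits maps such as a half-turn of a square
    or a matching of hooks, which are bijective on a part of the quadrant only. *)
Lemma weight_reindex (I J : choiceType) (f : I -> nat) (g : J -> nat)
    (phi : I -> J) :
  (forall i k, f i != 0 -> f k != 0 -> phi i = phi k -> i = k) ->
  (forall i, f i != 0 -> g (phi i) = f i) ->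
  (forall j, g j != 0 -> exists2 i, f i != 0 & phi i = j) ->
  finitely_supported f -> finitely_supported g /\ weight g = weight f.
Proof.
move=> inj gphi surj /finitely_supportedP[s us s0].
pose s' := [seq i <- s | f i != 0].
have us' : uniq s' by rewrite filter_uniq.
have s'0 i : i \notin s' -> f i = 0.
  rewrite mem_filter negb_and negbK => /orP[/eqP //|]; exact: s0.
have ut : uniq (map phi s').
  rewrite map_inj_in_uniq // => i k; rewrite !mem_filter => /andP[fi _] /andP[fk _].
  exact: inj.
have t0 j : j \notin map phi s' -> g j = 0.
  move=> jt; apply/eqP/negPn/negP => /surj[i fi ij]; case/negP: jt.
  by rewrite -ij map_f // mem_filter fi; apply: contraNT fi => /s0 ->.
split; first by apply/finitely_supportedP; exists (map phi s').
rewrite (weight_seq ut t0) (weight_seq us' s'0) big_map.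
by apply: eq_big_seq => i; rewrite mem_filter => /andP[fi _]; exact: gphi.
Qed.

(* [g] is a total inverse of [f] on [B]; keeping it explicit makes the relation
   symmetric without any choice. *)
Definition weight_equiv (X Y : Type) (A : set X) (wA : X -> nat)
    (B : set Y) (wB : Y -> nat) : Prop :=
  exists f g, (forall x, A x -> [/\ B (f x), g (f x) = x & wB (f x) = wA x]) /\
              (forall y, B y -> A (g y) /\ f (g y) = y).

Lemma weight_equiv_sym (X Y : Type) (A : set X) wA (B : set Y) wB :
  weight_equiv A wA B wB -> weight_equiv B wB A wA.
Proof.
move=> [f [g [fP gP]]]; exists g, f; split.
  by move=> y /gP[Ay fgy]; split=> //; case: (fP _ Ay) => _ _ <-; rewrite fgy.
by move=> x /fP[].
Qed.

Lemma weight_equiv_trans (X Y Z : Type) (A : set X) wA (B : set Y) wB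
    (C : set Z) wC :
  weight_equiv A wA B wB -> weight_equiv B wB C wC -> weight_equiv A wA C wC.
Proof.
move=> [f [g [fP gP]]] [f' [g' [fP' gP']]]; exists (f' \o f), (g \o g'); split.
  by move=> x /fP[/fP' /= [? -> ->] -> ->].
by move=> z /gP' /= [/gP[? ->] ->].
Qed.

Lemma weight_equiv_prod (X Y X' Y' : Type) (A : set X) wA (B : set Y) wB
    (A' : set X') wA' (B' : set Y') wB' :
  weight_equiv A wA B wB -> weight_equiv A' wA' B' wB' ->
  weight_equiv (A `*` A') (fun x => wA x.1 + wA' x.2)
               (B `*` B') (fun y => wB y.1 + wB' y.2).
Proof.
move=> [f [g [fP gP]]] [f' [g' [fP' gP']]].
exists (fun x => (f x.1, f' x.2)), (fun y => (g y.1, g' y.2)); split.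
  by move=> [x x'] [/= /fP[? -> ->] /fP'[? -> ->]].
by move=> [y y'] [/= /gP[? ->] /gP'[? ->]].
Qed.

Lemma weight_equiv_set_bij (X Y : Type) (A : set X) wA (B : set Y) wB :
  weight_equiv A wA B wB ->
  exists f, set_bij A B f /\ forall x, A x -> wA x = wB (f x).
Proof.
move=> [f [g [fP gP]]]; exists f; split; last by move=> x /fP[].
split; first by move=> x /fP[].
  move=> x y /set_mem /fP[_ fx _] /set_mem /fP[_ fy _] fxy.
  by rewrite -fx -fy fxy.
by move=> y /gP[Ay fgy]; exists (g y).
Qed.

(** Extension by 0 gives all fillings one fixed type, although the region they live on shrinks with
    every peeling. *)
Definition extension (P : pred (nat * nat)) (s : {b | P b} -> nat)
    (b : nat * nat) : nat :=
  if insub b is Some x then s x else 0.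

Lemma extension_val (P : pred (nat * nat)) (s : {b | P b} -> nat) x :
  extension s (val x) = s x.
Proof. by rewrite /extension valK. Qed.

Lemma extension_out (P : pred (nat * nat)) (s : {b | P b} -> nat) b :
  ~~ P b -> extension s b = 0.
Proof. by move=> Pb; rewrite /extension insubN. Qed.

Lemma extension_restriction (P : pred (nat * nat)) (t : nat * nat -> nat) :
  (forall b, ~~ P b -> t b = 0) -> extension (fun x : {b | P b} => t (val x)) = t.
Proof.
move=> t0; apply/funext => b; rewrite /extension.
by case: insubP => [x _ <-|/t0].
Qed.

Lemma weight_extension (P : pred (nat * nat)) (s : {b | P b} -> nat) :
  finitely_supported s ->
  finitely_supported (extension s) /\ weight (extension s) = weight s.
Proof.
apply: (weight_reindex (phi := val)) => [x y _ _ /val_inj //|x _|b].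
  exact: extension_val.
rewrite /extension; case: insubP => // x _ <- sx; by exists x.
Qed.

Lemma finitely_supported_restriction (P : pred (nat * nat))
    (t : nat * nat -> nat) :
  finitely_supported t -> finitely_supported (fun x : {b | P b} => t (val x)).
Proof.
move=> /finitely_supportedP[s us s0].
apply/finitely_supportedP; exists (pmap insub s); first exact: pmap_sub_uniq.
by move=> x; rewrite mem_pmap_sub; exact: s0.
Qed.

(** * Toggles *)

Definition below (s : nat * nat -> nat) (b : nat * nat) : nat :=
  maxn (s (b.1.+1, b.2)) (s (b.1, b.2.+1)).

(** The predecessors are genuine neighbours only when both coordinates are positive; [toggle]
    consults [above] only at boxes [beyond] a corner, where this holds. *)
Definition above (s : nat * nat -> nat) (b : nat * nat) : nat :=
  minn (s (b.1.-1, b.2)) (s (b.1, b.2.-1)).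

Definition beyond (b0 b : nat * nat) : bool :=
  (b0.1 < b.1) && (b.1 + b0.2 == b.2 + b0.1).

(** Each entry on the diagonal after [b0] is reflected in the interval from [below] to [above]. The
    truncated subtraction is exact once the entry is at most [above]. *)
Definition toggle (b0 : nat * nat) (s : nat * nat -> nat) (b : nat * nat) : nat :=
  if beyond b0 b then above s b + below s b - s b else s b.

Definition gap (b0 : nat * nat) (s : nat * nat -> nat) : nat :=
  s b0 - below s b0.

Definition peel_box (b0 : nat * nat) (s : nat * nat -> nat) (b : nat * nat) :=
  if b == b0 then 0 else toggle b0 s b.

Definition unpeel_box (b0 : nat * nat) (N : nat) (s : nat * nat -> nat)
    (b : nat * nat) :=
  if b == b0 then below s b0 + N else toggle b0 s b.

Definition down_closed (m : pred (nat * nat)) : Prop :=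
  forall i j i' j', i <= i' -> j <= j' -> m (i', j') -> m (i, j).

(* Fillings of the complement of [m], extended by 0 to the whole quadrant. *)
Definition skew (m : pred (nat * nat)) (s : nat * nat -> nat) : Prop :=
  (forall b, m b -> s b = 0) /\ (forall b, ~~ m b -> below s b <= s b).

Definition supported (n : nat) (s : nat * nat -> nat) : Prop :=
  forall i j, (n <= i) || (n <= j) -> s (i, j) = 0.

(** Neighbours of a diagonal box lie on the two adjacent diagonals, so toggling a whole diagonal at
    once never changes the bounds it uses. *)
Lemma beyond_neighbours b0 i j : beyond b0 (i, j) ->
  [/\ ~~ beyond b0 (i.+1, j), ~~ beyond b0 (i, j.+1),
      ~~ beyond b0 (i.-1, j) & ~~ beyond b0 (i, j.-1)] /\
  [/\ (i.+1, j) != b0, (i, j.+1) != b0, (i.-1, j) != b0 & (i, j.-1) != b0].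
Proof. by case: b0 => i0 j0; rewrite /beyond /= !xpair_eqE; split; split; lia. Qed.

Lemma beyond_above b0 i j : beyond b0 (i, j) ->
  [/\ b0.1 <= i.-1, b0.2 <= j, b0.1 <= i & b0.2 <= j.-1].
Proof. by case: b0 => i0 j0; rewrite /beyond /=; split; lia. Qed.

Lemma peel_boxE (b0 : nat * nat) s (b : nat * nat) :
  b != b0 -> peel_box b0 s b = toggle b0 s b.
Proof. by rewrite /peel_box => /negPf->. Qed.

Lemma unpeel_boxE (b0 : nat * nat) N s (b : nat * nat) :
  b != b0 -> unpeel_box b0 N s b = toggle b0 s b.
Proof. by rewrite /unpeel_box => /negPf->. Qed.

(** Leaving [t] free at [b0] makes this lemma and the next ones apply to [peel_box] and [unpeel_box]
    alike, since these differ at [b0] only. *)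
Lemma toggle_below (b0 : nat * nat) (s t : nat * nat -> nat) (i j : nat) :
  (forall b, b != b0 -> t b = toggle b0 s b) ->
  beyond b0 (i, j) -> below t (i, j) = below s (i, j).
Proof.
move=> tE /beyond_neighbours[[n1 n2 _ _] [ne1 ne2 _ _]].
by rewrite /below /= !tE // /toggle (negPf n1) (negPf n2).
Qed.

Lemma toggle_above (b0 : nat * nat) (s t : nat * nat -> nat) (i j : nat) :
  (forall b, b != b0 -> t b = toggle b0 s b) ->
  beyond b0 (i, j) -> above t (i, j) = above s (i, j).
Proof.
move=> tE /beyond_neighbours[[_ _ n1 n2] [_ _ ne1 ne2]].
by rewrite /above /= !tE // /toggle (negPf n1) (negPf n2).
Qed.

Lemma toggle_below_corner (b0 : nat * nat) (s t : nat * nat -> nat) :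
  (forall b, b != b0 -> t b = toggle b0 s b) ->
  below t b0 = below s b0.
Proof.
case: b0 => i0 j0 tE; rewrite /below !tE /toggle /beyond /= ?xpair_eqE; try lia.
by do 2!(case: ifP; first lia).
Qed.

(** A reflected entry stays between its bounds: being at least [below] settles the toggled boxes,
    and being at most [above] settles the boxes just before a toggled one. The last hypothesis keeps
    [b0], where [t] is arbitrary, from being a successor. *)
Lemma toggle_le (b0 : nat * nat) (s t : nat * nat -> nat) (i j : nat) :
  (forall b, b != b0 -> t b = toggle b0 s b) ->
  (forall i j, beyond b0 (i, j) ->
     below s (i, j) <= s (i, j) <= above s (i, j)) ->
  (i, j) != b0 -> below s (i, j) <= s (i, j) ->
  ((i.+1, j) == b0) || ((i, j.+1) == b0) = false ->
  below t (i, j) <= t (i, j).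
Proof.
move=> tE sP ne le_ij /norP[ne1 ne2].
case bij: (beyond b0 (i, j)).
  have /andP[_ le_above] := sP _ _ bij.
  by rewrite (toggle_below tE bij) tE // /toggle bij; lia.
rewrite /below /= !tE // /toggle bij.
move: le_ij; rewrite {1}/below /=.
case b1: (beyond b0 (i.+1, j)); case b2: (beyond b0 (i, j.+1)) => //.
(* The two successors of a box lie on different diagonals, so they are not both toggled. *)
- by move: b1 b2; rewrite /beyond /=; lia.
- by have := sP _ _ b1; rewrite /above /=; lia.
- by have := sP _ _ b2; rewrite /above /=; lia.
Qed.

Lemma toggleK (b0 : nat * nat) (s t : nat * nat -> nat) (i j : nat) :
  (forall i j, beyond b0 (i, j) ->
     below s (i, j) <= s (i, j) <= above s (i, j)) ->
  (forall b, b != b0 -> t b = toggle b0 s b) ->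
  (i, j) != b0 -> toggle b0 t (i, j) = s (i, j).
Proof.
move=> sP tE ne; rewrite /toggle; case: ifP => bij.
  rewrite (toggle_below tE bij) (toggle_above tE bij) tE // /toggle bij.
  by have := sP _ _ bij; lia.
by rewrite tE // /toggle bij.
Qed.

Lemma before_corner (m m' : pred (nat * nat)) (b0 : nat * nat) :
  down_closed m' -> (forall b, m' b = m b || (b == b0)) -> forall i j,
  i <= b0.1 -> j <= b0.2 -> (i, j) != b0 -> m (i, j).
Proof.
move=> m'down m'E i j le1 le2 ne; have : m' (i, j).
  have : m' b0 by rewrite m'E eqxx orbT.
  by case: b0 le1 le2 {ne m'E} => i0 j0 /=; exact: m'down.
by rewrite m'E (negPf ne) orbF.
Qed.

(** * Adding one corner to a shape: peeling and its inverse *)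

Section Peeling.

Variables (m m' : pred (nat * nat)) (b0 : nat * nat).
Hypotheses (mdown : down_closed m) (m'down : down_closed m').
Hypotheses (m'E : forall b, m' b = m b || (b == b0)) (mb0 : ~~ m b0).

Lemma outside_corner i j : b0.1 <= i -> b0.2 <= j -> ~~ m (i, j).
Proof.
by move=> le1 le2; apply: contra mb0; case: b0 le1 le2 => ? ? /=; exact: mdown.
Qed.

(** Both predecessors of a box beyond [b0] still lie weakly after [b0], hence outside [m], where the
    filling is known to decrease. *)
Lemma skew_le_above s i j :
  skew m s -> beyond b0 (i, j) -> s (i, j) <= above s (i, j).
Proof.
move=> [_ sle] bij; have [le1 le2 le3 le4] := beyond_above bij.
have := sle _ (outside_corner le1 le2); have := sle _ (outside_corner le3 le4).
case: b0 bij => i0 j0; rewrite /beyond /below /above /=.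
by case: i {le1 le2 le3 le4} => [|i]; case: j => [|j] /=; lia.
Qed.

Lemma skew'_le_above s i j :
  skew m' s -> beyond b0 (i, j) -> s (i, j) <= above s (i, j).
Proof.
move=> [_ sle] bij; have [le1 le2 le3 le4] := beyond_above bij.
have [_ [_ _ ne3 ne4]] := beyond_neighbours bij.
have /sle : ~~ m' (i.-1, j) by rewrite m'E negb_or ne3 outside_corner.
have /sle : ~~ m' (i, j.-1) by rewrite m'E negb_or ne4 outside_corner.
case: b0 bij => i0 j0; rewrite /beyond /below /above /=.
by case: i {le1 le2 le3 le4 ne3 ne4} => [|i]; case: j => [|j] /=; lia.
Qed.

Lemma beyond_out' i j : beyond b0 (i, j) -> ~~ m' (i, j).
Proof.
move=> bij; have [_ le2 le3 _] := beyond_above bij.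
rewrite m'E negb_or outside_corner //=.
by case: b0 bij => i0 j0; rewrite /beyond xpair_eqE /=; lia.
Qed.

Lemma beyond_out i j : beyond b0 (i, j) -> ~~ m (i, j).
Proof. by move/beyond_out'; rewrite m'E negb_or => /andP[]. Qed.

Lemma skew_beyond s i j : skew m s -> beyond b0 (i, j) ->
  below s (i, j) <= s (i, j) <= above s (i, j).
Proof.
move=> ss bij; rewrite skew_le_above // andbT.
by case: ss => _ -> //; exact: beyond_out.
Qed.

Lemma skew'_beyond s i j : skew m' s -> beyond b0 (i, j) ->
  below s (i, j) <= s (i, j) <= above s (i, j).
Proof.
move=> ss bij; rewrite skew'_le_above // andbT.
by case: ss => _ -> //; exact: beyond_out'.
Qed.

Lemma skew_peel_box s : skew m s -> skew m' (peel_box b0 s).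
Proof.
move=> ss; split=> -[i j].
  rewrite /peel_box m'E /toggle => mij; case: eqP => // ne.
  case: ifP => [/beyond_out|_]; first by case: (m _) mij => //= /eqP.
  by case: ss => s0 _; apply: s0; case: (m _) mij => //= /eqP.
rewrite m'E negb_or => /andP[mij ne].
apply: (toggle_le (peel_boxE s) _ ne) => [||].
- by move=> *; exact: skew_beyond.
- by case: ss => _ ->.
(* A box having [b0] as a successor precedes the corner, so it belongs to [m]. *)
apply: contraNF mij => nb; apply: (before_corner m'down m'E) => //.
  by case/orP: nb => /eqP <- /=.
by case/orP: nb => /eqP <- /=.
Qed.

Lemma skew_unpeel_box N s : skew m' s -> skew m (unpeel_box b0 N s).
Proof.
move=> ss; split=> -[i j].
  move=> mij; have ne : (i, j) != b0 by apply: contraTneq mij => ->.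
  rewrite unpeel_boxE // /toggle ifN; last by apply: contraL mij => /beyond_out.
  by case: ss => s0 _; rewrite s0 // m'E mij.
move=> mij; have [eq0|ne] := eqVneq (i, j) b0.
  rewrite eq0 (toggle_below_corner (unpeel_boxE N s)) /unpeel_box eqxx.
  exact: leq_addr.
apply: (toggle_le (unpeel_boxE N s) _ ne) => [||].
- by move=> *; exact: skew'_beyond.
- by case: ss => _ -> //; rewrite m'E negb_or mij.
apply: contraNF mij => nb; apply: (before_corner m'down m'E) => //.
  by case/orP: nb => /eqP <- /=.
by case/orP: nb => /eqP <- /=.
Qed.

Lemma peel_boxK s : skew m s -> unpeel_box b0 (gap b0 s) (peel_box b0 s) = s.
Proof.
move=> ss; apply/funext => -[i j]; have [eq0|ne] := eqVneq (i, j) b0.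
  rewrite eq0 /unpeel_box eqxx (toggle_below_corner (peel_boxE s)) /gap.
  by rewrite subnKC //; case: ss => _ ->.
rewrite unpeel_boxE // (toggleK _ (peel_boxE s)) // => *; exact: skew_beyond.
Qed.

Lemma unpeel_boxK N s : skew m' s -> peel_box b0 (unpeel_box b0 N s) = s.
Proof.
move=> ss; apply/funext => -[i j]; have [eq0|ne] := eqVneq (i, j) b0.
  by rewrite eq0 /peel_box eqxx; case: ss => -> //; rewrite m'E eqxx orbT.
rewrite peel_boxE // (toggleK _ (unpeel_boxE N s)) // => *; exact: skew'_beyond.
Qed.

End Peeling.

Lemma gap_unpeel_box b0 N s : gap b0 (unpeel_box b0 N s) = N.
Proof.
rewrite /gap (toggle_below_corner (unpeel_boxE N s)).
by rewrite /unpeel_box eqxx addKn.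
Qed.

Lemma supported_toggle n (b0 : nat * nat) (s t : nat * nat -> nat) : supported n s ->
  (forall b, b != b0 -> t b = toggle b0 s b) ->
  (supported n (fun b => if b == b0 then t b else 0)) -> supported n t.
Proof.
move=> sn tE t0 i j out; have [eq0|ne] := eqVneq (i, j) b0.
  by have := t0 _ _ out; rewrite eq0 eqxx.
rewrite tE // /toggle /above /below /=; case: ifP => bij; last exact: sn.
rewrite (sn i.+1 j) ?(sn i j.+1) ?(sn i j out); [|lia|lia].
(* One of the two predecessors is still outside the square, so the minimum [above] is 0. *)
case/orP: out => out; first by rewrite (sn i j.-1) ?out // minn0.
by rewrite (sn i.-1 j) ?out ?orbT // min0n.
Qed.

Lemma supported_peel_box n b0 s :
  supported n s -> supported n (peel_box b0 s).
Proof.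
move=> sn; apply: (supported_toggle sn (@peel_boxE b0 s)) => i j _.
by rewrite /peel_box; case: eqP.
Qed.

Lemma supported_unpeel_box n b0 N s : supported n s ->
  (N != 0 -> (b0.1 < n) && (b0.2 < n)) -> supported n (unpeel_box b0 N s).
Proof.
move=> sn Nn; apply: (supported_toggle sn (@unpeel_boxE b0 N s)) => i j out.
rewrite /unpeel_box; case: eqP => // eq0; rewrite -eq0 /= in Nn *.
by rewrite /below !sn /=; lia.
Qed.

(** * Diagonal sums and boundary labels *)

Definition grid (n : nat) : seq (nat * nat) :=
  [seq (i, j) | i <- iota 0 n, j <- iota 0 n].

Lemma mem_grid n i j : ((i, j) \in grid n) = (i < n) && (j < n).
Proof.
apply/allpairsP/andP => [[[k l] /= [+ + [-> ->]]]|[ltin ltjn]].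
  by rewrite !mem_iota.
by exists (i, j); rewrite !mem_iota.
Qed.

Lemma uniq_grid n : uniq (grid n).
Proof. by apply: allpairs_uniq; rewrite ?iota_uniq // => -[? ?] [? ?] _ _. Qed.

Section Contents.

Import GRing.Theory.
Local Open Scope ring_scope.

Definition content (b : nat * nat) : int := b.2%:Z - b.1%:Z.

Definition diag_sum (n : nat) (s : nat * nat -> nat) (c : int) : int :=
  \sum_(b <- grid n) if content b == c then (s b)%:Z else 0.

(** The diagonal may be read from any box [(i, j)] before which its entries vanish.
    Subtraction-free, [l + i = k + j] says that [(k, l)] lies on that diagonal. *)
Lemma diag_sumE n s i j : supported n s ->
  (forall k l, (l + i = k + j)%N -> (k < i)%N -> s (k, l) = 0%N) ->
  diag_sum n s (content (i, j)) = \sum_(k < n) (s (i + k, j + k)%N)%:Z.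
Proof.
move=> sn s0; set c := content _.
rewrite -(big_mkord xpredT (fun k => (s (i + k, j + k)%N)%:Z)).
transitivity (\sum_(b <- [seq ((i + k)%N, (j + k)%N) | k <- iota 0 n])
                if content b == c then (s b)%:Z else 0).
  apply: eq_big_support.
  - exact: uniq_grid.
  - by rewrite map_inj_uniq ?iota_uniq // => k l [/addnI].
  - move=> [k l]; rewrite mem_grid => out; rewrite sn ?if_same //; lia.
  move=> [k l] /negP out; case: eqP => //; rewrite /c /content /= => eqc.
  have [lt|le] := ltnP k i; first by rewrite s0 //; lia.
  rewrite sn //; apply/negPn/negP => lt; apply: out; apply/mapP.
  by exists (k - i)%N; [rewrite mem_iota; lia | congr pair; lia].
rewrite big_map /index_iota subn0; apply: eq_bigr => k _.
by rewrite ifT // /c /content /=; apply/eqP; lia.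
Qed.

(** [y q] is the label of the boundary step at position [q]; the diagonal of content [c] leaves the
    boundary between the steps [c] and [c + 1]. For [y] the identity every factor is 1, which gives
    the ordinary weight. *)
Definition label_weight (n : nat) (y : int -> int) (s : nat * nat -> nat) : int :=
  \sum_(b <- grid n) (s b)%:Z * (y (content b + 1) - y (content b)).

Definition swap_label (c : int) (y : int -> int) (q : int) : int :=
  y (if q == c then c + 1 else if q == c + 1 then c else q).

End Contents.

(** [A] and [A'] are a diagonal before and after peeling, [B] and [C] its neighbours. The maximum
    left over from index [k] meets the minimum from [k.+1], and since min + max is the sum of the
    two entries, everything telescopes except [N]. *)
Lemma toggled_diagonal (A A' B C : nat -> nat) (n N : nat) :
  A' 0 = 0 -> A 0 = N + maxn (B 0) (C 0) ->
  (forall k, A' k.+1 + A k.+1 = minn (B k) (C k) + maxn (B k.+1) (C k.+1)) ->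
  A n = 0 -> A' n = 0 -> B n = 0 -> C n = 0 ->
  \sum_(k < n) A k + \sum_(k < n) A' k =
  \sum_(k < n) B k + \sum_(k < n) C k + N.
Proof.
move=> A'0 A0 AS An A'n Bn Cn.
have recr (F : nat -> nat) l : \sum_(k < l.+1) F k = \sum_(k < l) F k + F l.
  exact: big_ord_recr.
have partial l : \sum_(k < l.+1) A k + \sum_(k < l.+1) A' k =
    \sum_(k < l) B k + \sum_(k < l) C k + N + maxn (B l) (C l).
  elim: l => [|l IH]; first by rewrite !recr !big_ord0 A0 A'0; lia.
  rewrite recr [X in _ + X = _]recr [X in _ = X + _ + _ + _]recr.
  rewrite [X in _ = _ + X + _ + _]recr.
  by have := AS l; move: IH; lia.
by have := partial n; rewrite !recr An A'n Bn Cn; lia.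
Qed.

(** * Change of the weight under one peeling *)

Section PeelingWeight.

Import GRing.Theory.
Local Open Scope ring_scope.

Variables (m m' : pred (nat * nat)) (b0 : nat * nat) (n : nat).
Variable s : nat * nat -> nat.
Hypotheses (mdown : down_closed m) (m'down : down_closed m').
Hypotheses (m'E : forall b, m' b = m b || (b == b0)) (mb0 : ~~ m b0).
Hypotheses (sskew : skew m s) (sn : supported n s).

Let c := content b0.
Let s' := peel_box b0 s.

Lemma inside_corner i j : (i <= b0.1)%N -> (j <= b0.2)%N -> (i, j) != b0 ->
  s (i, j) = 0%N.
Proof.
move=> le1 le2 ne; apply: sskew.1.
exact: before_corner m'down m'E _ _ le1 le2 ne.
Qed.

Lemma peel_box_off b : content b != c -> s' b = s b.
Proof.
case: b b0 @c @s' => i j [i0 j0]; rewrite /content /peel_box /toggle /beyond /=.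
move=> ne; rewrite !ifN //; first by apply: contra ne; lia.
by apply: contra ne => /eqP[-> ->].
Qed.

Lemma diag_sum_peel :
  diag_sum n s c + diag_sum n s' c =
  diag_sum n s (c + 1) + diag_sum n s (c - 1) + (gap b0 s)%:Z.
Proof.
have s'skew : skew m' s' := skew_peel_box mdown m'down m'E mb0 sskew.
have s'n : supported n s' := supported_peel_box b0 sn.
have b0E : b0 = (b0.1, b0.2) by case: b0.
(* The adjacent diagonals are read from the two successors of [b0]; all their earlier boxes lie in
   [m]. *)
have -> : c + 1 = content (b0.1, b0.2.+1) by rewrite /c /content /=; lia.
have -> : c - 1 = content (b0.1.+1, b0.2) by rewrite /c /content /=; lia.
rewrite /c b0E !diag_sumE //.
- rewrite -!rmorph_sum -!rmorphD /=; congr (_%:Z).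
  apply: (@toggled_diagonal (fun k => s (b0.1 + k, b0.2 + k)%N)
    (fun k => s' (b0.1 + k, b0.2 + k)%N)
    (fun k => s (b0.1 + k, b0.2.+1 + k)%N)
    (fun k => s (b0.1.+1 + k, b0.2 + k)%N)).
  + by rewrite !addn0 -b0E /s' /peel_box eqxx.
  + rewrite !addn0 -b0E /gap -[X in (_ = _ + X)%N]maxnC -/(below s b0) subnK //.
    by case: sskew => _ ->.
  + move=> k; set b := (_, _); have bb : beyond b0 b by rewrite /beyond /=; lia.
    have /andP[_ le_b] := skew_beyond mdown m'E mb0 sskew bb.
    have ne : b != b0 by apply: contraTneq bb => ->; rewrite /beyond ltnn.
    rewrite /s' peel_boxE // /toggle bb subnK ?(leq_trans le_b (leq_addr _ _)) //.
    by rewrite /above /below /b /= !addnS !addSn /= minnC maxnC.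
  + by apply: sn; lia.
  + by apply: s'n; lia.
  + by apply: sn; lia.
  + by apply: sn; lia.
all: move=> k l /= eqkl lt.
- by apply: inside_corner; [| |apply/eqP => E; move: eqkl lt; rewrite -E] => /=; lia.
- by apply: inside_corner; [| |apply/eqP => E; move: eqkl lt; rewrite -E] => /=; lia.
- have ne : (k, l) != b0 by apply: contraTneq lt => <-; rewrite ltnn.
  have nb : ~~ beyond b0 (k, l) by rewrite /beyond /=; lia.
  by rewrite /s' peel_boxE // /toggle (negPf nb) inside_corner //; lia.
by apply: inside_corner; [| |apply/eqP => E; move: eqkl lt; rewrite -E] => /=; lia.
Qed.

(** With D = y (c + 1) - y c, the swap turns the factor D on the diagonal [c] into -D and adds D to
    the factors on the diagonals [c - 1] and [c + 1]. The total change is therefore D times the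
    combination of sums in [diag_sum_peel], that is, D times the gap. *)
Lemma label_weight_peel y :
  label_weight n y s = label_weight n (swap_label c y) s' +
                       (y (c + 1) - y c) * (gap b0 s)%:Z.
Proof.
have -> : (gap b0 s)%:Z = diag_sum n s c + diag_sum n s' c -
    diag_sum n s (c + 1) - diag_sum n s (c - 1).
  by rewrite diag_sum_peel; ring.
apply/eqP; rewrite addrC -subr_eq; apply/eqP.
rewrite /label_weight /diag_sum -big_split /= -!sumrB mulr_sumr.
apply: eq_bigr => b _; set q := content b.
have [qc|qc] := eqVneq q c.
  rewrite qc /swap_label eqxx.
  have -> : (c + 1 == c) = false by lia.
  have -> : (c == c + 1) = false by lia.
  have -> : (c == c - 1) = false by lia.
  by rewrite eqxx; ring.
rewrite peel_box_off // /swap_label (negPf qc).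
have [->|qc1] := eqVneq q (c + 1).
  have -> : (c + 1 + 1 == c) = false by lia.
  have -> : (c + 1 + 1 == c + 1) = false by lia.
  have -> : (c + 1 == c - 1) = false by lia.
  by ring.
have [->|qc2] := eqVneq q (c - 1).
  by rewrite subrK eqxx; ring.
have -> : (q + 1 == c) = false by lia.
have -> : (q + 1 == c + 1) = false by lia.
by ring.
Qed.

End PeelingWeight.

(** * Peeling in Cantor order *)

(* Any enumeration of the quadrant by a linear extension of its order would do. *)
Fixpoint cantor (k : nat) : nat * nat :=
  if k is k'.+1 then
    let b := cantor k' in if b.2 is j.+1 then (b.1.+1, j) else (0, b.1.+1)
  else (0, 0).

(** A triangular number counts the boxes on the earlier antidiagonals, and the row gives the place
    on the current one. *)
Definition rank (b : nat * nat) : nat := 'C((b.1 + b.2).+1, 2) + b.1.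

Lemma cantorK : cancel cantor rank.
Proof.
elim=> [|k IH] //=; rewrite -[in RHS]IH /rank.
case: (cantor k) => i [|j] /=; first by rewrite add0n !addn0 binS bin1; lia.
by rewrite addSnnS addnS.
Qed.

Lemma rank_le i j i' j' : i <= i' -> j <= j' -> rank (i, j) <= rank (i', j').
Proof. by move=> le1 le2; rewrite leq_add // leq_bin2l // ltnS leq_add. Qed.

Lemma rankK : cancel rank cantor.
Proof.
have inj : injective rank.
  have lt (b b' : nat * nat) : b.1 + b.2 < b'.1 + b'.2 -> rank b < rank b'.
    move=> ltb; apply: (@leq_trans 'C((b.1 + b.2).+2, 2)).
      by rewrite binS bin1 /rank; lia.
    by rewrite (leq_trans _ (leq_addr _ _)) // leq_bin2l.
  move=> b b' eqb; have [/lt|/lt|eqs] := ltngtP (b.1 + b.2) (b'.1 + b'.2).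
  - by rewrite eqb ltnn.
  - by rewrite eqb ltnn.
  move: eqb; rewrite /rank eqs => /addnI eq1.
  by rewrite (surjective_pairing b) (surjective_pairing b') eq1; congr pair; lia.
by move=> b; apply: inj; rewrite cantorK.
Qed.

Section Enumeration.

Variables lam lam' : nat -> nat.
(* This Galois connection says that [lam] is a partition with conjugate [lam']. *)
Hypothesis conj_lam : forall i j, (j < lam i) = (i < lam' j).

(** A chain of shapes starting at [diagram lam]: step [k] adds the box [cantor k], or nothing if
    that box is already in the diagram. *)
Definition shape (k : nat) : pred (nat * nat) :=
  fun b => diagram lam b || (rank b < k).

Lemma diagram_down_closed : down_closed (diagram lam).
Proof.
move=> i j i' j' le1 le2; rewrite /diagram /= => lt.
by rewrite conj_lam (leq_ltn_trans le1) // -conj_lam (leq_ltn_trans le2).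
Qed.

Lemma shape_down_closed k : down_closed (shape k).
Proof.
move=> i j i' j' le1 le2 /orP[ins|lt]; apply/orP.
  by left; apply: diagram_down_closed ins.
by right; apply: leq_ltn_trans lt; exact: rank_le.
Qed.

Lemma shapeS k b : shape k.+1 b = shape k b || (b == cantor k).
Proof.
rewrite /shape ltnS leq_eqVlt (can2_eq rankK cantorK).
by case: (diagram _ _) => //=; rewrite orbC.
Qed.

Lemma shape_cantor k : shape k (cantor k) = diagram lam (cantor k).
Proof. by rewrite /shape cantorK ltnn orbF. Qed.

Lemma shapeS_inside k : diagram lam (cantor k) -> shape k.+1 = shape k.
Proof.
move=> ins; apply/funext => b; rewrite shapeS; case: eqP => [->|]; rewrite ?orbF //.
by rewrite shape_cantor ins.
Qed.

Fixpoint peel (k : nat) (s : nat * nat -> nat) : nat * nat -> nat :=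
  if k is k'.+1 then
    if diagram lam (cantor k') then peel k' s
    else peel_box (cantor k') (peel k' s)
  else s.

Fixpoint unpeel (a : nat * nat -> nat) (k : nat) (t : nat * nat -> nat) :
    nat * nat -> nat :=
  if k is k'.+1 then
    unpeel a k' (if diagram lam (cantor k') then t
                 else unpeel_box (cantor k') (a (cantor k')) t)
  else t.

Definition coefficients (s : nat * nat -> nat) (b : nat * nat) : nat :=
  if diagram lam b then 0 else gap b (peel (rank b) s).

Fixpoint label (k : nat) : int -> int :=
  if k is k'.+1 then
    if diagram lam (cantor k') then label k'
    else swap_label (content (cantor k')) (label k')
  else id.

Lemma shape0 : shape 0 = diagram lam.
Proof. by apply/funext => b; rewrite /shape ltn0 orbF. Qed.

Lemma corner k : ~~ diagram lam (cantor k) -> ~~ shape k (cantor k).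
Proof. by rewrite shape_cantor. Qed.

Lemma skew_peel k s : skew (diagram lam) s -> skew (shape k) (peel k s).
Proof.
move=> ss; elim: k => [|k IH] /=; first by rewrite shape0.
case: ifPn => [/shapeS_inside->//|out].
exact (skew_peel_box (@shape_down_closed k) (@shape_down_closed k.+1)
  (shapeS k) (corner out) IH).
Qed.

Lemma supported_peel n k s : supported n s -> supported n (peel k s).
Proof.
by move=> sn; elim: k => //= k IH; case: ifP => // _; exact: supported_peel_box.
Qed.

(** The induction generalizes [t], because [unpeel] reinserts the last box first and hands the
    enlarged filling down to [k]. *)
Lemma peel_unpeel a k t : skew (shape k) t ->
  [/\ skew (diagram lam) (unpeel a k t), peel k (unpeel a k t) = t &
      forall b, ~~ diagram lam b -> rank b < k ->
        coefficients (unpeel a k t) b = a b].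
Proof.
elim: k t => [|k IH] t tskew /=; first by rewrite shape0 in tskew; split.
case: ifPn => [ins|out].
  rewrite shapeS_inside // in tskew; have [? -> coefE] := IH _ tskew.
  split=> // b outb; rewrite ltnS leq_eqVlt => /predU1P[rb|]; last exact: coefE.
  by rewrite -rb rankK (negPf outb) in ins.
set t' := unpeel_box _ _ _; have t'skew : skew (shape k) t'.
  exact (skew_unpeel_box (@shape_down_closed k) (@shape_down_closed k.+1)
    (shapeS k) (corner out) _ tskew).
have [? peelE coefE] := IH _ t'skew; split=> //.
  by rewrite peelE (unpeel_boxK (@shape_down_closed k) (shapeS k) (corner out)).
move=> b outb; rewrite ltnS leq_eqVlt => /predU1P[rb|]; last exact: coefE.
(* The last box reinserted is the one whose gap is read after exactly [k] peelings, when the filling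
   is [t'] again. *)
by rewrite /coefficients (negPf outb) rb peelE -{1}(rankK b) rb gap_unpeel_box -rb rankK.
Qed.

Lemma supported_unpeel n a k t :
  supported n a -> supported n t -> supported n (unpeel a k t).
Proof.
move=> an; elim: k t => //= k IH t tn; apply: IH; case: ifP => // _.
apply: supported_unpeel_box => //; apply: contraR => out.
rewrite [cantor k]surjective_pairing an //; lia.
Qed.

Lemma supported_coefficients n s : supported n s -> supported n (coefficients s).
Proof.
move=> sn i j out; rewrite /coefficients /gap.
by rewrite (supported_peel _ sn out) sub0n if_same.
Qed.

(** Peelings are undone one at a time: the peeled filling and the coefficient at the corner
    determine the filling before. *)
Lemma peel_inj k s t : skew (diagram lam) s -> skew (diagram lam) t ->
  coefficients s = coefficients t -> peel k s = peel k t -> s = t.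
Proof.
move=> ss ts coefE; elim: k => [//|k IH] /=; case: ifPn => // out eqst.
apply: IH; have := congr1 (fun a => a (cantor k)) coefE.
rewrite /coefficients (negPf out) cantorK => gapE.
have peelK u : skew (diagram lam) u -> _ := fun us =>
  peel_boxK (@shape_down_closed k) (shapeS k) (corner out) (skew_peel k us).
by rewrite -(peelK s) // -(peelK t) // gapE eqst.
Qed.

Lemma grid_rank n i j : i < n -> j < n -> rank (i, j) < rank (n, n).
Proof.
move=> lti ltj; have : rank (i, j) <= rank (n, n) by apply: rank_le; exact: ltnW.
by rewrite leq_eqVlt => /predU1P[/(can_inj rankK)[eqi _]|//]; lia.
Qed.

(** All boxes of the [n] by [n] square have rank below that of [(n, n)], so by then the square is
    swallowed by the shape and nothing is left. *)
Lemma peel_supported0 n s b :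
  skew (diagram lam) s -> supported n s -> peel (rank (n, n)) s b = 0.
Proof.
move=> ss sn; have [sh0 _] := skew_peel (rank (n, n)) ss.
case: b => i j; case out: ((n <= i) || (n <= j)).
  by rewrite (supported_peel _ sn out).
by apply: sh0; rewrite /shape grid_rank ?orbT //; lia.
Qed.

(** For a box outside the diagram the subtractions are exact and count the outside boxes before it
    in its row and in its column; the box itself is the final 1. *)
Definition outer_hook (b : nat * nat) : nat :=
  (b.2 - lam b.1) + (b.1 - lam' b.2) + 1.

End Enumeration.

Lemma supported_finitely n s : supported n s -> finitely_supported s.
Proof.
move=> sn; apply/finitely_supportedP; exists (grid n); first exact: uniq_grid.
by move=> [i j]; rewrite mem_grid => out; apply: sn; lia.
Qed.

Lemma finitely_supported_bound s :
  finitely_supported s -> exists n, supported n s.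
Proof.
move=> /finitely_supportedP[l _ l0].
exists (\max_(b <- l) maxn b.1 b.2).+1 => i j out; apply: l0; apply/negP => ijl.
have : maxn i j <= \max_(b <- l) maxn b.1 b.2.
  by rewrite (big_rem (i, j)) //= leq_maxl.
by lia.
Qed.

Lemma weight_equiv_bij (X Y : Type) (x0 : X) (A : set X) (wA : X -> nat)
    (B : set Y) (wB : Y -> nat) (f : X -> Y) :
  (forall x, A x -> B (f x)) -> (forall x, A x -> wB (f x) = wA x) ->
  (forall x x', A x -> A x' -> f x = f x' -> x = x') ->
  (forall y, B y -> exists2 x, A x & f x = y) ->
  weight_equiv A wA B wB.
Proof.
move=> fAB fw inj surj; have ex y : exists x, B y -> A x /\ f x = y.
  by have [/surj[x Ax fx]|nBy] := pselect (B y); [exists x | exists x0].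
have [g gP] := choice ex.
exists f, g; split=> // x Ax; have [Ag fg] := gP _ (fAB _ Ax).
by split; [exact: fAB | exact: inj | exact: fw].
Qed.

(* The first box outside [m] in row [i] carries the label of the vertical step
   of the boundary of [m] in that row, and similarly for columns. *)
Definition boundary_labels (m : pred (nat * nat)) (y : int -> int)
    (r c : nat -> int) : Prop :=
  (forall i j, ~~ m (i, j) -> (forall j', j' < j -> m (i, j')) ->
     y (content (i, j)) = r i) /\
  (forall i j, ~~ m (i, j) -> (forall i', i' < i -> m (i', j)) ->
     y (content (i, j) + 1)%R = c j).

(** A corner is the first outside box both of its row and of its column. *)
Lemma boundary_labels_corner (m m' : pred (nat * nat)) b0 y r c :
  down_closed m' -> (forall b, m' b = m b || (b == b0)) -> ~~ m b0 ->
  boundary_labels m y r c ->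
  y (content b0) = r b0.1 /\ y (content b0 + 1)%R = c b0.2.
Proof.
case: b0 => i0 j0 m'down m'E mb0 [rowP colP] /=; split.
  apply: rowP => // j' lt; apply: (before_corner m'down m'E); rewrite ?xpair_eqE /=; lia.
apply: colP => // i' lt; apply: (before_corner m'down m'E); rewrite ?xpair_eqE /=; lia.
Qed.

(** Adding [b0], of content c, moves the vertical step of its row from position c to c + 1 and the
    horizontal step of its column from c + 1 to c. The steps of other rows and columns stay where
    they were, at positions different from both. *)
Lemma boundary_labels_swap (m m' : pred (nat * nat)) b0 y r c :
  down_closed m -> down_closed m' ->
  (forall b, m' b = m b || (b == b0)) -> ~~ m b0 ->
  boundary_labels m y r c -> boundary_labels m' (swap_label (content b0) y) r c.
Proof.
move=> mdown m'down m'E mb0 yP.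
have [yr yc] := boundary_labels_corner m'down m'E mb0 yP.
have before := before_corner m'down m'E.
case: b0 m'E mb0 yr yc before => i0 j0 m'E mb0 yr yc before /=.
have beyond_out i j : i0 <= i -> j0 <= j -> ~~ m (i, j).
  by move=> le1 le2; apply: contra mb0; exact: mdown.
case: yP => rowP colP; split=> i j; rewrite m'E negb_or => /andP[mij ne] prefix.
  have [eqi|nei] := eqVneq i i0.
    have eqj : j = j0.+1.
      have gt : j0 < j.
        rewrite ltnNge; apply: contra mij => le; apply: before => //=; lia.
      apply/eqP; rewrite eqn_leq gt andbT leqNgt; apply/negP => /prefix.
      by rewrite m'E (negPf (beyond_out _ _ _ _)) ?xpair_eqE /=; lia.
    rewrite eqi eqj /swap_label /content /= ifN; last by lia.
    by rewrite ifT; [rewrite -yr | lia].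
  (* In a row above [b0] the first outside box has content at least c + 2, in a row below at most c
     - 1. *)
  have neq : (content (i, j) != content (i0, j0)) /\
             (content (i, j) != content (i0, j0) + 1)%R.
    rewrite /content /=; have [le|gt] := leqP i i0.
      have : j0 < j; last by lia.
      rewrite ltnNge; apply: contra mij => lej; exact: before.
    have : j <= j0; last by lia.
    rewrite leqNgt; apply/negP => /prefix.
    by rewrite m'E (negPf (beyond_out _ _ _ _)) ?xpair_eqE /=; lia.
  rewrite /swap_label (negPf neq.1) (negPf neq.2); apply: rowP => // j' /prefix.
  by rewrite m'E xpair_eqE (negPf nei) orbF.
have [eqj|nej] := eqVneq j j0.
  have eqi : i = i0.+1.
    have gt : i0 < i.
      rewrite ltnNge; apply: contra mij => le; apply: before => //=; lia.
    apply/eqP; rewrite eqn_leq gt andbT leqNgt; apply/negP => /prefix.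
    by rewrite m'E (negPf (beyond_out _ _ _ _)) ?xpair_eqE /=; lia.
  rewrite eqi eqj /swap_label /content /= ifT; last by lia.
  by rewrite -yc.
have neq : ((content (i, j) + 1 != content (i0, j0)) /\
           (content (i, j) != content (i0, j0)))%R.
  rewrite /content /=; have [le|gt] := leqP j j0.
    have : i0 < i; last by lia.
    rewrite ltnNge; apply: contra mij => lei; exact: before.
  have : i <= i0; last by lia.
  rewrite leqNgt; apply/negP => /prefix.
  by rewrite m'E (negPf (beyond_out _ _ _ _)) ?xpair_eqE /=; lia.
rewrite /swap_label (negPf neq.1) (inj_eq (GRing.addIr 1%R)) (negPf neq.2).
apply: colP => // i' /prefix.
by rewrite m'E xpair_eqE (negPf nej) andbF orbF.
Qed.

(** * Skew fillings as arrays weighted by outer hooks *)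

Section Coefficients.
Variables lam lam' : nat -> nat.
Hypothesis conj_lam : forall i j, (j < lam i) = (i < lam' j).

(** A step keeps as its label its initial position on the boundary of [lam], so the labels of row
    [i] and column [j] do not depend on [k]. *)
Lemma boundary_labels_label k :
  boundary_labels (shape lam k) (label lam k)
    (fun i => (lam i)%:Z - i%:Z)%R (fun j => j%:Z + 1 - (lam' j)%:Z)%R.
Proof.
elim: k => [|k IH] /=.
  rewrite shape0 /diagram /content; split=> i j /=.
    move=> out prefix; case: (ltngtP j (lam i)) out => // [lt _|-> //].
    by have := prefix _ lt; rewrite ltnn.
  rewrite conj_lam => out prefix; case: (ltngtP i (lam' j)) out => // [lt _|-> _].
    by have := prefix _ lt; rewrite conj_lam ltnn.
  by rewrite /content /=; ring.
case: ifPn => [/shapeS_inside->//|out].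
exact (boundary_labels_swap (shape_down_closed conj_lam (k:=k))
  (shape_down_closed conj_lam (k:=k.+1)) (shapeS lam k) (corner out) IH).
Qed.

Lemma label_outer_hook k : ~~ diagram lam (cantor k) ->
  (label lam k (content (cantor k) + 1) - label lam k (content (cantor k)) =
   (outer_hook lam lam' (cantor k))%:Z)%R.
Proof.
move=> out; have [-> ->] := boundary_labels_corner
  (shape_down_closed conj_lam (k:=k.+1)) (shapeS lam k) (corner out)
  (boundary_labels_label k).
move: out; rewrite /outer_hook; case: (cantor k) => i j /= out.
by have := out; rewrite /diagram /= in out *; rewrite conj_lam; lia.
Qed.

Lemma label_weight_peelN n k s : skew (diagram lam) s -> supported n s ->
  (label_weight n id s =
   (\sum_(l < k) outer_hook lam lam' (cantor l) * coefficients lam s (cantor l))%N%:Z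
   + label_weight n (label lam k) (peel lam k s))%R.
Proof.
move=> ss sn; elim: k => [|k IH]; first by rewrite big_ord0 GRing.add0r.
rewrite big_ord_recr /=.
have -> : coefficients lam s (cantor k) =
    if diagram lam (cantor k) then 0 else gap (cantor k) (peel lam k s).
  by rewrite /coefficients cantorK.
case: ifPn => [_|out]; first by rewrite muln0 addn0.
rewrite IH (label_weight_peel (shape_down_closed conj_lam (k:=k))
  (shape_down_closed conj_lam (k:=k.+1)) (shapeS lam k) (corner out)
  (skew_peel conj_lam k ss) (supported_peel lam k sn)) label_outer_hook //.
by rewrite PoszD PoszM; ring.
Qed.

Lemma weight_coefficients n s : skew (diagram lam) s -> supported n s ->
  weight (fun b => outer_hook lam lam' b * coefficients lam s b) = weight s.
Proof.
(* After [K] peelings the filling is zero, so only the sum over the first [K] boxes remains; these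
   include the whole square supporting the coefficients. *)
move=> ss sn; set K := rank (n, n).
rewrite (@weight_seq _ [seq cantor k | k <- iota 0 K]); first last.
- move=> [i j] out; rewrite (supported_coefficients lam sn) ?muln0 //.
  apply: contraR out => inn; apply/mapP; exists (rank (i, j)); last by rewrite rankK.
  by rewrite mem_iota /= add0n; apply: grid_rank; lia.
- by rewrite (map_inj_uniq (can_inj cantorK)) iota_uniq.
rewrite (weight_seq (uniq_grid n)); last first.
  by move=> [i j]; rewrite mem_grid => out; apply: sn; lia.
apply/eqP; rewrite -eqz_nat; apply/eqP.
have := label_weight_peelN K ss sn; rewrite [X in (_ + X)%R]big1 ?GRing.addr0.
  have -> : \sum_(b <- [seq cantor k | k <- iota 0 K])
        outer_hook lam lam' b * coefficients lam s b =
      \sum_(l < K) outer_hook lam lam' (cantor l) * coefficients lam s (cantor l).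
    rewrite big_map -(big_mkord xpredT (fun l =>
      outer_hook lam lam' (cantor l) * coefficients lam s (cantor l))).
    by rewrite /index_iota subn0.
  move=> <-; rewrite /label_weight GRing.rmorph_sum /=.
  by apply: eq_bigr => b _; ring.
by move=> b _; rewrite (peel_supported0 conj_lam) // GRing.mul0r.
Qed.

Lemma supportedW n n' s : n <= n' -> supported n s -> supported n' s.
Proof. by move=> le sn i j out; apply: sn; lia. Qed.

Lemma coefficients_inj s t : skew (diagram lam) s -> skew (diagram lam) t ->
  finitely_supported s -> finitely_supported t ->
  coefficients lam s = coefficients lam t -> s = t.
Proof.
move=> ss ts /finitely_supported_bound[n sn] /finitely_supported_bound[n' tn'].
have {}sn := supportedW (leq_maxl n n') sn.
have {}tn' := supportedW (leq_maxr n n') tn'.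
move/(peel_inj conj_lam (k := rank (maxn n n', maxn n n')) ss ts); apply.
by apply/funext => b; rewrite !(peel_supported0 conj_lam).
Qed.

Lemma coefficients_surj n a : (forall b, diagram lam b -> a b = 0) ->
  supported n a ->
  exists s, [/\ skew (diagram lam) s, supported n s & coefficients lam s = a].
Proof.
move=> a0 an; set K := rank (n, n).
(* The preimage is built backwards from the zero filling, by reinserting the first [K] boxes with
   the prescribed coefficients. *)
have zeroskew : skew (shape lam K) (fun=> 0) by split=> // b _; rewrite /below maxnn.
have [sskew _ coefE] := peel_unpeel conj_lam a zeroskew.
have sn : supported n (unpeel lam a K (fun=> 0)) by exact: supported_unpeel.
exists (unpeel lam a K (fun=> 0)); split=> //; apply/funext => -[i j].
have [ins|out] := boolP (diagram lam (i, j)).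
  by rewrite /coefficients ins a0.
case inn : ((n <= i) || (n <= j)).
  by rewrite an // (supported_coefficients lam sn).
by apply: coefE => //; apply: grid_rank; lia.
Qed.

Lemma coefficients_diagram s b : diagram lam b -> coefficients lam s b = 0.
Proof. by rewrite /coefficients => ->. Qed.

(** The bound [n] is kept on both sides because the half-turn acts on fillings of a fixed square. *)
Lemma skew_equiv_bounded n :
  weight_equiv [set s | skew (diagram lam) s /\ supported n s] (@weight _)
    [set a | (forall b, diagram lam b -> a b = 0) /\ supported n a]
    (fun a => weight (fun b => outer_hook lam lam' b * a b)).
Proof.
apply: (@weight_equiv_bij _ _ (fun=> 0) _ _ _ _ (coefficients lam)).
- move=> s [_ sn]; split; last exact: supported_coefficients.
  exact: coefficients_diagram.
- by move=> s [ss sn]; exact: weight_coefficients sn.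
- move=> s t [ss /supported_finitely sn] [ts /supported_finitely tn].
  exact: coefficients_inj.
- by move=> a [a0 /(coefficients_surj a0)[s [ss sn <-]]]; exists s.
Qed.

Lemma skew_equiv :
  weight_equiv [set s | skew (diagram lam) s /\ finitely_supported s] (@weight _)
    [set a | (forall b, diagram lam b -> a b = 0) /\ finitely_supported a]
    (fun a => weight (fun b => outer_hook lam lam' b * a b)).
Proof.
apply: (@weight_equiv_bij _ _ (fun=> 0) _ _ _ _ (coefficients lam)).
- move=> s [_ /finitely_supported_bound[n sn]]; split.
    exact: coefficients_diagram.
  exact: supported_finitely (supported_coefficients lam sn).
- move=> s [ss /finitely_supported_bound[n sn]]; exact: weight_coefficients sn.
- by move=> s t [ss sn] [ts tn]; exact: coefficients_inj.
move=> a [a0 /finitely_supported_bound[n /(coefficients_surj a0)[s [ss sn <-]]]].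
by exists s => //; split=> //; exact: supported_finitely sn.
Qed.

End Coefficients.

(** * Half-turn *)

Definition rotation (n : nat) (b : nat * nat) : nat * nat := (n.-1 - b.1, n.-1 - b.2).

Definition rotate (n : nat) (t : nat * nat -> nat) (b : nat * nat) : nat :=
  if (b.1 < n) && (b.2 < n) then t (rotation n b) else 0.

Lemma supported_rotate n t : supported n (rotate n t).
Proof. by move=> i j out; rewrite /rotate ifN //=; lia. Qed.

Lemma rotateK n t : supported n t -> rotate n (rotate n t) = t.
Proof.
move=> tn; apply/funext => -[i j]; rewrite /rotate /rotation /=.
case: ifP => [/andP[lti ltj]|out]; last by rewrite tn //; lia.
rewrite ifT; last by lia.
by congr (t (_, _)); lia.
Qed.

Lemma weight_rotate n f g :
  supported n f -> supported n g ->
  (forall i j, i < n -> j < n -> g (i, j) = f (rotation n (i, j))) ->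
  weight f = weight g.
Proof.
move=> fn gn gE.
have inn (h : nat * nat -> nat) i j :
    supported n h -> h (i, j) != 0 -> (i < n) && (j < n).
  by move=> hn; apply: contraR => out; rewrite hn //; lia.
have rotKK i j : i < n -> j < n -> rotation n (rotation n (i, j)) = (i, j).
  by move=> *; rewrite /rotation /=; congr pair; lia.
case: (@weight_reindex _ _ g f (rotation n)) => [[i j] [k l]|[i j]|[i j]||//].
- move=> /(inn _ _ _ gn) /andP[? ?] /(inn _ _ _ gn) /andP[? ?] eqr.
  by rewrite -[LHS]rotKK // eqr rotKK.
- by move=> /(inn _ _ _ gn) /andP[? ?]; rewrite gE.
- move=> fij; have /andP[lti ltj] := inn _ _ _ fn fij.
  exists (rotation n (i, j)); last exact: rotKK.
  rewrite [rotation n (i, j)]surjective_pairing gE -?surjective_pairing ?rotKK //.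
    by rewrite /=; lia.
  by rewrite /=; lia.
exact: supported_finitely gn.
Qed.

Section Rotation.

Variables (lam lam' : nat -> nat) (n : nat).
Hypothesis conj_lam : forall i j, (j < lam i) = (i < lam' j).
Hypotheses (lam_le : lam 0 <= n) (lam'_le : lam' 0 <= n).

(** The part of the square outside the diagram, turned by 180 degrees into a diagram again. *)
Definition complement (l : nat -> nat) (i : nat) : nat :=
  if i < n then n - l (n.-1 - i) else 0.

Lemma diagram_bound i j : diagram lam (i, j) -> (i < n) && (j < n).
Proof.
move=> ins; apply/andP; split.
  rewrite (leq_trans _ lam'_le) // -conj_lam.
  exact: (diagram_down_closed conj_lam (leqnn i) (leq0n j) ins).
rewrite (leq_trans _ lam_le) //.
exact: (diagram_down_closed conj_lam (leq0n i) (leqnn j) ins).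
Qed.

Lemma conj_complement i j :
  (j < complement lam i) = (i < complement lam' j).
Proof.
rewrite /complement; have := conj_lam (n.-1 - i) (n.-1 - j).
by case: (ltnP i n); case: (ltnP j n); lia.
Qed.

Lemma diagram_complement i j : i < n -> j < n ->
  diagram (complement lam) (i, j) = ~~ diagram lam (rotation n (i, j)).
Proof. by move=> lti ltj; rewrite /diagram /complement /rotation /= lti; lia. Qed.

(** The usual hook length: with coordinates from 0, each difference is an arm or a leg plus one, so
    the box is counted twice. *)
Definition inner_hook (b : nat * nat) : nat :=
  (lam b.1 - b.2) + (lam' b.2 - b.1) - 1.

Definition reverse (r : nat * nat -> nat) : Prop :=
  (forall b, ~~ diagram lam b -> r b = 0) /\
  (forall b c, diagram lam b -> diagram lam c -> next_box b c -> r b <= r c).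

Lemma supported_diagram t :
  (forall b, ~~ diagram lam b -> t b = 0) -> supported n t.
Proof. by move=> t0 i j out; apply: t0; apply/negP => /diagram_bound; lia. Qed.

(** The half-turn reverses the order of boxes and carries the diagram of [lam] onto the part of the
    square outside [complement lam]; beyond the square all values are 0. *)
Lemma skew_rotate r : reverse r -> skew (diagram (complement lam)) (rotate n r).
Proof.
move=> [r0 rle]; split=> -[i j] /=.
  rewrite /rotate; case: ifP => //= /andP[lti ltj].
  by rewrite diagram_complement //; exact: r0.
move=> out; rewrite /below /rotate /=.
case: (ltnP i n) => lti /=; last by rewrite ltnNge (leqW lti).
case: (ltnP j n) => ltj /=; last by rewrite (ltnNge j.+1) (leqW ltj) andbF.
move: out; rewrite diagram_complement // negbK => ins.
have down k l : k <= n.-1 - i -> l <= n.-1 - j -> diagram lam (k, l).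
  by move=> le1 le2; apply: (diagram_down_closed conj_lam le1 le2).
rewrite geq_max; apply/andP; split; case: ifP => //= lt'.
  apply: rle => //; first by apply: down => /=; lia.
  by left; rewrite /rotation /=; congr pair; lia.
apply: rle => //; first by apply: down => /=; lia.
by right; rewrite /rotation /=; congr pair; lia.
Qed.

Lemma reverse_rotate s :
  skew (diagram (complement lam)) s -> reverse (rotate n s).
Proof.
move=> [s0 sle]; split=> [[i j] out|[i j] c insb insc].
  rewrite /rotate; case: ifP => //= /andP[lti ltj]; apply: s0.
  rewrite diagram_complement /rotation /=; try lia.
  by move: out; congr (~~ diagram lam (_, _)); lia.
have /andP[lti ltj] := diagram_bound insb.
case=> c_eq; rewrite {}c_eq in insc *; have /andP[/= lti' ltj'] := diagram_bound insc.
all: rewrite /rotate /= ?lti ?ltj ?lti' ?ltj' /=.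
all: apply: leq_trans (sle _ _); last first.
- by rewrite diagram_complement /rotation /=; try lia; rewrite negbK;
    move: insc; congr (is_true (diagram lam (_, _))) => /=; lia.
- by rewrite /below leq_max /rotation /=; apply/orP; left;
    apply: eq_leq; congr (s (_, _)); lia.
- by rewrite diagram_complement /rotation /=; try lia; rewrite negbK;
    move: insc; congr (is_true (diagram lam (_, _))) => /=; lia.
by rewrite /below leq_max /rotation /=; apply/orP; right;
  apply: eq_leq; congr (s (_, _)); lia.
Qed.

Lemma outer_hook_complement i j :
  i < n -> j < n -> ~~ diagram (complement lam) (i, j) ->
  outer_hook (complement lam) (complement lam') (i, j) =
  inner_hook (rotation n (i, j)).
Proof.
move=> lti ltj; rewrite diagram_complement // negbK => ins.
have le1 : lam (n.-1 - i) <= n.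
  case E: (lam _) => [//|l]; have : diagram lam (n.-1 - i, l) by rewrite /diagram /= E.
  by case/diagram_bound/andP.
have le2 : lam' (n.-1 - j) <= n.
  case E: (lam' _) => [//|l]; have : diagram lam (l, n.-1 - j).
    by rewrite /diagram /= conj_lam E.
  by case/diagram_bound/andP.
have := ins; rewrite /diagram /= => lt; have := lt; rewrite conj_lam.
by rewrite /outer_hook /inner_hook /complement /rotation /= lti ltj; lia.
Qed.

Lemma reverse_equiv :
  weight_equiv [set r | reverse r] (@weight _)
    [set a | forall b, ~~ diagram lam b -> a b = 0]
    (fun a => weight (fun b => inner_hook b * a b)).
Proof.
have rotP : weight_equiv [set r | reverse r] (@weight _)
    [set s | skew (diagram (complement lam)) s /\ supported n s] (@weight _).
  exists (rotate n), (rotate n); split.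
    move=> r rP; have rn : supported n r by apply: supported_diagram; case: rP.
    split; last 1 first.
    - apply: (weight_rotate (@supported_rotate n r) rn) => i j lti ltj.
      by rewrite -{1}(rotateK rn) {1}/rotate /= lti ltj.
    - by split; [exact: skew_rotate | exact: supported_rotate].
    - exact: rotateK.
  move=> s [ss sn]; split; last exact: rotateK.
  exact: reverse_rotate.
apply: (weight_equiv_trans rotP).
apply: (weight_equiv_trans (skew_equiv_bounded conj_complement n)).
exists (rotate n), (rotate n); split.
  move=> a [a0 an]; split; last 1 first.
  - apply: (@weight_rotate n).
    + by move=> i j out; rewrite supported_rotate ?muln0.
    + by move=> i j out; rewrite an ?muln0.
    move=> i j lti ltj; rewrite -{1}(rotateK an) {1}/rotate /= lti ltj /=.
    (* Hooks correspond only outside the complementary diagram; inside it the array vanishes, which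
       makes both products 0. *)
    have [ins|out] := boolP (diagram (complement lam) (i, j)).
      have := a0 _ ins; rewrite -{1}(rotateK an) {1}/rotate /= lti ltj /= => ->.
      by rewrite !muln0.
    by rewrite outer_hook_complement.
  - move=> [i j] out; rewrite /rotate; case: ifP => //= /andP[lti ltj]; apply: a0.
    rewrite diagram_complement /rotation /=; try lia.
    by move: out; congr (~~ diagram lam (_, _)); lia.
  - exact: rotateK.
move=> a a0; have an : supported n a by exact: supported_diagram.
split; last exact: rotateK.
split; last exact: supported_rotate.
move=> [i j] ins; rewrite /rotate; case: ifP => //= /andP[lti ltj]; apply: a0.
by rewrite -diagram_complement.
Qed.

End Rotation.

(** * Hook counts *)

Lemma count_sum (T : Type) (a : pred T) (s : seq T) :
  count a s = \sum_(x <- s) a x.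
Proof. by elim: s => [|x s IH]; rewrite ?big_nil //= big_cons IH. Qed.

Lemma sum_lt m n : m <= n -> \sum_(i <- iota 0 n) (i < m) = m.
Proof.
move=> le; rewrite -(subnKC le) iotaD big_cat /= [X in _ + X]big1_seq ?addn0; last first.
  by move=> i; rewrite mem_iota add0n => /andP[_ /andP[mi _]]; rewrite ltnNge mi.
rewrite -[RHS](size_iota 0 m) -sum1_size; apply: eq_big_seq => i.
by rewrite mem_iota /= => ->.
Qed.

Section HookCount.

Variables (lam lam' : nat -> nat) (n d : nat).
Hypothesis conj_lam : forall i j, (j < lam i) = (i < lam' j).
Hypotheses (lam_le : lam 0 + d <= n) (lam'_le : lam' 0 + d <= n).

(* Walking along the boundary of the diagram in the n by n square and numbering
   its 2n unit steps, [row_step i] is the number of the vertical step in row i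
   and [col_step j] that of the horizontal step in column j. *)
Let row_step i := lam i + (n.-1 - i).
Let col_step j := n + j - lam' j.

Lemma part_le i : lam i <= lam 0.
Proof.
by rewrite leqNgt conj_lam; apply/negP => /(leq_ltn_trans (leq0n i));
  rewrite -conj_lam ltnn.
Qed.

Lemma conj_le j : lam' j <= lam' 0.
Proof.
by rewrite leqNgt -conj_lam; apply/negP => /(leq_ltn_trans (leq0n j));
  rewrite conj_lam ltnn.
Qed.

(** The 2n steps have pairwise distinct numbers below 2n, hence take each of them exactly once. *)
Lemma step_cover p : p < n + n ->
  \sum_(j <- iota 0 n) (col_step j == p) + \sum_(i <- iota 0 n) (row_step i == p) = 1.
Proof.
move=> lt; set L := [seq col_step j | j <- iota 0 n] ++ [seq row_step i | i <- iota 0 n].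
have -> : \sum_(j <- iota 0 n) (col_step j == p) +
          \sum_(i <- iota 0 n) (row_step i == p) = count_mem p L.
  by rewrite count_cat !count_map -!count_sum.
have decr i i' : i <= i' -> lam i' <= lam i.
  move=> le; rewrite leqNgt conj_lam; apply/negP => /(leq_ltn_trans le).
  by rewrite -conj_lam ltnn.
have decr' j j' : j <= j' -> lam' j' <= lam' j.
  move=> le; rewrite leqNgt -conj_lam; apply/negP => /(leq_ltn_trans le).
  by rewrite conj_lam ltnn.
have uL : uniq L.
  rewrite cat_uniq !map_inj_in_uniq ?iota_uniq /= ?andbT.
  (* A vertical and a horizontal step differ by the hook length of the box where their row and
     column meet, which is positive. *)
  - apply/hasPn => q /mapP[i]; rewrite mem_iota /= => ltin ->.
    apply/negP => /mapP[j]; rewrite mem_iota /= /row_step /col_step => ltjn.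
    by have := conj_lam i j; have := part_le i; have := conj_le j; lia.
  - move=> i i'; rewrite !mem_iota /= /row_step => lti lti' eqi.
    by case: (ltngtP i i') => // ltk; have := decr _ _ (ltnW ltk); lia.
  - move=> j j'; rewrite !mem_iota /= /col_step => ltj ltj' eqj.
    have := conj_le j; have := conj_le j'.
    by case: (ltngtP j j') => // ltk; have := decr' _ _ (ltnW ltk); lia.
have sub : {subset L <= iota 0 (n + n)}.
  move=> q; rewrite mem_cat mem_iota /= => /orP[] /mapP[k]; rewrite mem_iota /= => ltk ->.
    by rewrite /col_step; lia.
  by rewrite /row_step; have := part_le k; lia.
have [|_ eqL] := uniq_min_size uL sub.
  by rewrite size_cat !size_map !size_iota.
by rewrite count_uniq_mem // eqL mem_iota lt.
Qed.

(** An outer hook of length [d] is a vertical step with a horizontal step [d] places later; for an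
    inner hook the horizontal one is [d] places earlier. With [Q] the number of pairs of vertical
    steps at distance [d], the outer count plus [Q] is the number of all vertical steps, and the
    inner count plus [Q] is the number of those at position at least [d]. *)
Lemma hook_count :
  count (fun b => ~~ diagram lam b && (outer_hook lam lam' b == d)) (grid n) =
  count (fun b => diagram lam b && (inner_hook lam lam' b == d)) (grid n) + d.
Proof.
pose Q := \sum_(i <- iota 0 n) \sum_(i' <- iota 0 n) (row_step i' == row_step i + d).
have outE : count (fun b => ~~ diagram lam b && (outer_hook lam lam' b == d)) (grid n) =
    \sum_(i <- iota 0 n) \sum_(j <- iota 0 n) (col_step j == row_step i + d).
  rewrite count_sum big_allpairs_dep; apply: eq_big_seq => i.
  rewrite mem_iota /= => ltin; apply: eq_big_seq => j; rewrite mem_iota /= => ltjn.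
  congr nat_of_bool; rewrite /diagram /outer_hook /col_step /row_step /=.
  by have := conj_lam i j; have := part_le i; have := conj_le j; lia.
have inE : count (fun b => diagram lam b && (inner_hook lam lam' b == d)) (grid n) =
    \sum_(i <- iota 0 n) \sum_(j <- iota 0 n) (col_step j + d == row_step i).
  rewrite count_sum big_allpairs_dep; apply: eq_big_seq => i.
  rewrite mem_iota /= => ltin; apply: eq_big_seq => j; rewrite mem_iota /= => ltjn.
  congr nat_of_bool; rewrite /diagram /inner_hook /col_step /row_step /=.
  by have := conj_lam i j; have := part_le i; have := conj_le j; lia.
have outQ : count (fun b => ~~ diagram lam b && (outer_hook lam lam' b == d)) (grid n)
    + Q = n.
  rewrite outE -big_split /= -[RHS](size_iota 0 n) -sum1_size.
  apply: eq_big_seq => i; rewrite mem_iota /= => ltin; apply: step_cover.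
  by rewrite /row_step; have := part_le i; lia.
have inQ : count (fun b => diagram lam b && (inner_hook lam lam' b == d)) (grid n)
    + Q = n - d.
  rewrite inE /Q [X in _ + X]exchange_big -big_split /=.
  rewrite -[RHS](@sum_lt _ n (leq_subr d n)).
  apply: eq_big_seq => i; rewrite mem_iota /= => ltin.
  (* The last [d] rows of the square are empty, so their vertical steps are exactly the first [d]
     steps. *)
  have -> : (i < n - d) = (d <= row_step i).
    rewrite /row_step; case: (ltnP i (n - d)) => lt; first by lia.
    suff -> : lam i = 0 by lia.
    by apply/eqP; rewrite -leqn0 leqNgt conj_lam; lia.
  case: (leqP d (row_step i)) => le.
    have <- : row_step i - d + d = row_step i by rewrite subnK.
    under eq_bigr do rewrite eqn_add2r.
    under [X in _ + X]eq_bigr do rewrite eq_sym eqn_add2r.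
    by apply: step_cover; rewrite /row_step; have := part_le i; lia.
  by rewrite !big1 // => k _; apply/eqP; rewrite eqb0; lia.
by move: outQ inQ; lia.
Qed.

End HookCount.

(** Elements with the same place in the lists [L d] and [M d] are matched; [i0] and [j0] are
    defaults for [nth]. *)
Lemma fiber_matching (I J : eqType) (i0 : I) (j0 : J) (h : I -> nat) (k : J -> nat)
    (L : nat -> seq I) (M : nat -> seq J) :
  (forall d, uniq (L d)) -> (forall d, uniq (M d)) ->
  (forall d, size (L d) = size (M d)) ->
  (forall d i, i \in L d -> h i = d) -> (forall d j, j \in M d -> k j = d) ->
  exists (phi : I -> J) (psi : J -> I),
    (forall i, i \in L (h i) ->
       [/\ phi i \in M (h i), k (phi i) = h i & psi (phi i) = i]) /\
    (forall j, j \in M (k j) ->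
       [/\ psi j \in L (k j), h (psi j) = k j & phi (psi j) = j]).
Proof.
move=> uL uM sz hL kM.
exists (fun i => nth j0 (M (h i)) (index i (L (h i)))),
       (fun j => nth i0 (L (k j)) (index j (M (k j)))); split=> [i iL|j jM].
  have inM : nth j0 (M (h i)) (index i (L (h i))) \in M (h i).
    by rewrite mem_nth // -sz index_mem.
  split=> //; first exact: kM.
  by rewrite (kM _ _ inM) index_uniq // ?nth_index // -sz index_mem.
have inL : nth i0 (L (k j)) (index j (M (k j))) \in L (k j).
  by rewrite mem_nth // sz index_mem.
split=> //; first exact: hL.
by rewrite (hL _ _ inL) index_uniq // ?nth_index // sz index_mem.
Qed.

Lemma finitely_supported_seq (I : choiceType) (s : seq I) (f : I -> nat) :
  (forall i, i \notin s -> f i = 0) -> finitely_supported f.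
Proof.
move=> s0; apply/finitely_supportedP; exists (undup s); first exact: undup_uniq.
by move=> i; rewrite mem_undup; exact: s0.
Qed.

Lemma weight_sum (I J : choiceType) (G : I + J -> nat) :
  finitely_supported (fun i => G (inl i)) ->
  finitely_supported (fun j => G (inr j)) ->
  weight G = weight (fun i => G (inl i)) + weight (fun j => G (inr j)).
Proof.
move=> /finitely_supportedP[s us s0] /finitely_supportedP[t ut t0].
rewrite (weight_seq us s0) (weight_seq ut t0).
rewrite (@weight_seq _ (map inl s ++ map inr t)).
- by rewrite big_cat !big_map.
- rewrite cat_uniq !map_inj_uniq ?us ?ut ?andbT /=; try by move=> ? ? [].
  by apply/hasPn => _ /mapP[j _ ->]; apply/mapP => -[].
move=> [i|j]; rewrite mem_cat negb_or => /andP[nl nr].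
  by apply: s0; apply: contra nl; exact: map_f.
by apply: t0; apply: contra nr; exact: map_f.
Qed.

(** * Matching of boxes by hook length *)

Section HookMatching.

Variables lam lam' : nat -> nat.
Hypothesis conj_lam : forall i j, (j < lam i) = (i < lam' j).

Definition plane_hook : nat * nat -> nat := outer_hook (fun=> 0) (fun=> 0).

Lemma hook_matching :
  exists (phi : nat * nat -> (nat * nat) + (nat * nat)) psi,
  [/\ forall b, ~~ diagram lam b ->
        [/\ if phi b is inl c then diagram lam c else true,
            (match phi b with inl c => inner_hook lam lam' c | inr c => plane_hook c end)
              = outer_hook lam lam' b & psi (phi b) = b],
      forall c, diagram lam c ->
        ~~ diagram lam (psi (inl c)) /\ phi (psi (inl c)) = inl c &
      forall c, ~~ diagram lam (psi (inr c)) /\ phi (psi (inr c)) = inr c].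
Proof.
(* A square of this size contains every box with hook length [d] of each of the three kinds and
   satisfies the bounds of [hook_count]. *)
pose n d := lam 0 + lam' 0 + d.
pose out d := [seq b <- grid (n d) | ~~ diagram lam b && (outer_hook lam lam' b == d)].
pose ins d := [seq b <- grid (n d) | diagram lam b && (inner_hook lam lam' b == d)].
pose all d := [seq b <- grid (n d) | ~~ diagram (fun=> 0) b && (plane_hook b == d)].
pose k (x : (nat * nat) + (nat * nat)) :=
  match x with inl c => inner_hook lam lam' c | inr c => plane_hook c end.
have memout b : (b \in out (outer_hook lam lam' b)) = ~~ diagram lam b.
  rewrite mem_filter eqxx andbT; case: b => i j.
  have [//|/=] := boolP (diagram lam (i, j)).
  rewrite mem_grid /diagram /outer_hook /n /= => out_ij.
  have := part_le conj_lam i; have := conj_le conj_lam j; lia.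
have memins b : (b \in ins (inner_hook lam lam' b)) = diagram lam b.
  rewrite mem_filter eqxx andbT; case: b => i j.
  have [/=|//] := boolP (diagram lam (i, j)).
  rewrite mem_grid /diagram /n /= => lt; have := lt; rewrite conj_lam.
  have := part_le conj_lam i; have := conj_le conj_lam j; lia.
have memall b : b \in all (plane_hook b).
  by case: b => i j; rewrite mem_filter eqxx mem_grid /n /plane_hook /outer_hook /=; lia.
case: (@fiber_matching _ _ (0, 0) (inr (0, 0)) (outer_hook lam lam') k out
  (fun d => map inl (ins d) ++ map inr (all d))) => [d|d|d|d b|d x|].
- by rewrite filter_uniq ?uniq_grid.
- rewrite cat_uniq !map_inj_uniq ?filter_uniq ?uniq_grid //=; try by move=> ? ? [].
  by rewrite andbT; apply/hasPn => _ /mapP[j _ ->]; apply/mapP => -[].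
- rewrite size_cat !size_map !size_filter.
  (* Applied to the empty diagram, which has no inner hooks, the same count shows that [all d] has
     [d] elements. *)
  rewrite (hook_count conj_lam) ?(@hook_count (fun=> 0) (fun=> 0)) /n //; try lia.
  by rewrite [X in _ = _ + (X + _)](_ : _ = 0) //; elim: (grid _).
- by rewrite /out mem_filter => /andP[/andP[_ /eqP]].
- by rewrite mem_cat => /orP[] /mapP[b];
    rewrite /ins /all mem_filter => /andP[/andP[_ /eqP <-] _] ->.
move=> phi [psi [phiP psiP]]; exists phi, psi.
have inlP c : (inl c \in map inl (ins (k (inl c))) ++ map inr (all (k (inl c)))) =
    diagram lam c.
  rewrite mem_cat -memins mem_map; last by move=> ? ? [].
  by rewrite orbC; case: mapP => // -[].
split=> [b|c|c].
- rewrite -memout => /phiP[memphi kphi psiK]; split=> //.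
  by case: (phi b) memphi kphi => [c|c] memc kc //; rewrite -inlP kc.
- rewrite -inlP => /psiP[mempsi hpsi phiK]; split=> //.
  by rewrite -memout hpsi.
have /psiP[mempsi hpsi phiK] :
    inr c \in map inl (ins (k (inr c))) ++ map inr (all (k (inr c))).
  by rewrite mem_cat; apply/orP; right; rewrite map_f.
by split=> //; rewrite -memout hpsi.
Qed.

Lemma hook_array_equiv :
  weight_equiv [set a | (forall b, diagram lam b -> a b = 0) /\ finitely_supported a]
    (fun a => weight (fun b => outer_hook lam lam' b * a b))
    ([set a | forall b, ~~ diagram lam b -> a b = 0] `*`
     [set a : nat * nat -> nat | (forall b, diagram (fun=> 0) b -> a b = 0) /\
                                 finitely_supported a])
    (fun x => weight (fun b => inner_hook lam lam' b * x.1 b) +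
              weight (fun b => plane_hook b * x.2 b)).
Proof.
have [phi [psi [phiP psilP psirP]]] := hook_matching.
pose n := maxn (lam 0) (lam' 0).
have diagram_supported a :
    (forall b, ~~ diagram lam b -> a b = 0) -> finitely_supported a.
  move=> a0; apply: (@supported_finitely n).
  exact: (supported_diagram conj_lam (leq_maxl _ _) (leq_maxr _ _) a0).
exists (fun a => (fun b => if diagram lam b then a (psi (inl b)) else 0,
                  fun b => a (psi (inr b)))).
exists (fun x b => if diagram lam b then 0 else
                   match phi b with inl c => x.1 c | inr c => x.2 c end).
split=> [a [a0 afin]|[a1 a2] [/= a1z [_ a2fin]]]; last first.
  split; first split.
  - by move=> b ->.
  - have /finitely_supportedP[s _ s0] := diagram_supported _ a1z.
    have /finitely_supportedP[t _ t0] := a2fin.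
    apply: (@finitely_supported_seq _
      ([seq psi (inl c) | c <- s] ++ [seq psi (inr c) | c <- t])).
    move=> b; rewrite mem_cat negb_or => /andP[bs bt]; case: ifPn => // out.
    have [_ _ psiK] := phiP _ out; case E: (phi b) psiK => [c|c] psiK.
      by apply: s0; apply: contra bs => cs; rewrite -psiK; exact: map_f.
    by apply: t0; apply: contra bt => ct; rewrite -psiK; exact: map_f.
  congr pair; apply/funext => b; last first.
    by have [/negPf-> ->] := psirP b.
  case: ifPn => [ins|/a1z->//].
  by have [/negPf-> ->] := psilP _ ins.
have fin2 : finitely_supported (fun b => a (psi (inr b))).
  have /finitely_supportedP[s _ s0] := afin.
  apply: (@finitely_supported_seq _
    (pmap (fun b => if phi b is inr c then Some c else None) s)) => c cs.
  apply: s0; apply: contra cs => psis; have [_ phiK] := psirP c.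
  by rewrite mem_pmap; apply/mapP; exists (psi (inr c)); rewrite ?phiK.
split=> /=.
- by split=> //=; move=> b /negPf->.
- apply/funext => b; case: ifPn => [/a0->//|out].
  have [ins _ psiK] := phiP _ out.
  by case E: (phi b) ins psiK => [c|c] => [->|_] ->.
pose f1 b := if diagram lam b then a (psi (inl b)) else 0.
have f1z b : ~~ diagram lam b -> f1 b = 0 by rewrite /f1 => /negPf->.
(* [G] lives on the disjoint union of the two targets: its weight splits as a sum, and reindexing
   along [phi] identifies it with the weight of the original array. *)
pose G (x : (nat * nat) + (nat * nat)) := match x with
  | inl c => inner_hook lam lam' c * f1 c
  | inr c => plane_hook c * a (psi (inr c)) end.
have finh (h : nat * nat -> nat) (u : nat * nat -> nat) : finitely_supported u ->
    finitely_supported (fun b => h b * u b).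
  move=> /finitely_supportedP[s _ s0]; apply: (@finitely_supported_seq _ s) => b bs.
  by rewrite s0 ?muln0.
have weightG : weight G = weight (fun b => inner_hook lam lam' b * f1 b) +
                          weight (fun b => plane_hook b * a (psi (inr b))).
  by apply: weight_sum; apply: finh => //; exact: diagram_supported.
rewrite -[LHS]weightG.
have outP b : outer_hook lam lam' b * a b != 0 -> ~~ diagram lam b.
  by apply: contraNN => /a0->; rewrite muln0.
case: (@weight_reindex _ _ (fun b => outer_hook lam lam' b * a b) G phi) => //.
- move=> b c /outP/phiP[_ _ psiKb] /outP/phiP[_ _ psiKc] eqphi.
  by rewrite -psiKb eqphi psiKc.
- move=> b /outP/phiP[]; rewrite /G /f1.
  by case: (phi b) => [c ->|c _] -> ->.
- move=> x Gx; have [outx phiK] : ~~ diagram lam (psi x) /\ phi (psi x) = x.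
    case: x Gx => c /= Gc; last exact: psirP.
    by apply: psilP; apply: contraNT Gc => /f1z->; rewrite muln0.
  exists (psi x) => //; have [_ <- _] := phiP _ outx.
  by move: Gx; rewrite phiK /G /f1; case: (x) => [c|//]; case: ifP; rewrite ?muln0.
exact: finh.
Qed.

End HookMatching.

(** * The bijection *)

Lemma conjugate_exists (lam : nat -> nat) : is_partition lam ->
  exists lam' : nat -> nat, forall i j, (j < lam i) = (i < lam' j).
Proof.
move=> [decr /finite_seqP[s sE]].
have homo i i' : i <= i' -> lam i' <= lam i.
  by move=> /subnKC <-; elim: (i' - i) => [|k IH];
    rewrite ?addn0 ?addnS ?(leq_trans _ IH).
have ex j : exists i, lam i <= j.
  (* This row comes after all nonzero ones; the conjugate then takes the least row whose part is at
     most [j]. *)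
  exists (\max_(i <- s) i).+1; rewrite leqNgt; apply/negP => lt.
  have : (\max_(i <- s) i).+1 \in s.
    have : [set i | lam i != 0] (\max_(i <- s) i).+1.
      by rewrite /= -lt0n (leq_ltn_trans _ lt).
    by rewrite sE.
  by move=> /(@leq_bigmax_seq _ s xpredT id) /(_ isT); rewrite ltnn.
exists (fun j => ex_minn (ex j)) => i j; case: ex_minnP => m le min.
rewrite !ltnNge; congr negb; apply/idP/idP => [/min//|/homo le'].
exact: leq_trans le' le.
Qed.

Lemma skew_plane_partition_equiv (lam : nat -> nat) :
  weight_equiv (skew_plane_partition lam) (@weight _)
    [set s | skew (diagram lam) s /\ finitely_supported s] (@weight _).
Proof.
exists (fun s => extension s), (fun t x => t (val x)).
split=> [s [sle sfin]|t [[t0 tle] tfin]].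
  have [efin weightE] := weight_extension sfin.
  split=> //; last by apply/funext => x; exact: extension_val.
  split=> //; split=> [b ins|b out]; first by rewrite extension_out // negbK.
  have step c : next_box b c -> extension s c <= extension s b.
    rewrite {2}/extension insubT => bc; rewrite /extension.
    by case: insubP => // y _ yc; apply: sle; rewrite yc.
  by rewrite geq_max !step // ; [right | left].
split; last by apply: extension_restriction => b; rewrite negbK; exact: t0.
split; last exact: finitely_supported_restriction.
move=> x y; have := tle _ (valP x); rewrite /below geq_max => /andP[le1 le2].
by case=> ->.
Qed.

Lemma reverse_plane_partition_equiv (lam lam' : nat -> nat) :
  (forall i j, (j < lam i) = (i < lam' j)) ->
  weight_equiv (reverse_plane_partition lam) (@weight _)
    [set r | reverse lam r] (@weight _).
Proof.
move=> conj_lam; pose n := maxn (lam 0) (lam' 0).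
exists (fun r => extension r), (fun t x => t (val x)); split=> [r rle|t [t0 tle]].
  have rfin : finitely_supported r.
    have out b : ~~ diagram lam b -> extension r b = 0 by exact: extension_out.
    have -> : r = (fun x => extension r (val x)).
      by apply/funext => x; rewrite extension_val.
    apply: finitely_supported_restriction; apply: (@supported_finitely n).
    exact: (supported_diagram conj_lam (leq_maxl _ _) (leq_maxr _ _) out).
  have [efin weightE] := weight_extension rfin.
  split=> //; last by apply/funext => x; exact: extension_val.
  split=> [b|b c insb insc bc]; first exact: extension_out.
  by rewrite /extension !insubT; apply: rle.
split; last exact: extension_restriction.
by move=> x y xy; apply: tle => //; exact: valP.
Qed.

Lemma plane_partitionE :
  plane_partition = [set s | skew (diagram (fun=> 0)) s /\ finitely_supported s].
Proof.
apply/seteqP; split=> s [sle sfin]; split=> //.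
  by split=> // b _; rewrite /below geq_max !sle //; [right | left].
by move=> b c bc; have := sle.2 b isT; rewrite geq_max => /andP[le1 le2]; case: bc => ->.
Qed.

Theorem theorem4p9 (lam : nat -> nat) (lamP : is_partition lam) :
  exists f : (outside lam -> nat) -> (inside lam -> nat) * (nat * nat -> nat),
    set_bij (skew_plane_partition lam)
            (reverse_plane_partition lam `*` plane_partition) f /\
    (forall s, skew_plane_partition lam s ->
       weight s = weight (f s).1 + weight (f s).2).
Proof.
have [lam' conj_lam] := conjugate_exists lamP.
apply: (@weight_equiv_set_bij _ _ _ (@weight _) _ (fun x => weight x.1 + weight x.2)).
have rpp := weight_equiv_trans (reverse_plane_partition_equiv conj_lam)
  (reverse_equiv conj_lam (leq_maxl (lam 0) (lam' 0)) (leq_maxr (lam 0) (lam' 0))).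
have pp := @skew_equiv (fun=> 0) (fun=> 0) (fun=> fun=> erefl).
(* Skew plane partitions become arrays on outer hooks, which split into an array on inner hooks and
   one on the hooks of the empty diagram; reading [rpp] and [pp] backwards turns these into the
   pair. *)
apply: weight_equiv_trans (@skew_plane_partition_equiv lam) _.
apply: weight_equiv_trans (skew_equiv conj_lam) _.
apply: weight_equiv_trans (hook_array_equiv conj_lam) _.
rewrite plane_partitionE; apply: weight_equiv_sym.
exact: weight_equiv_prod rpp pp.
Qed.
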